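(* Let $X$ be a compact metric space and let $f:X\to X$ be a distal homeomorphism. Then $E(X,f,\mathbb{N})=E(X,f,\mathbb{Z})$.
   Context: $\mathbb{N}$ is the set of non-negative integers. $E(X,f,\mathbb{N})$ and $E(X,f,\mathbb{Z})$ are the closures in $X^X$, with the product topology, of $\{f^n:n\in\mathbb{N}\}$ and $\{f^n:n\in\mathbb{Z}\}$ respectively. With $d$ the metric of $X$, a homeomorphism $f$ is distal if $\inf\{d(f^n(x),f^n(y)):n\in\mathbb{Z}\}>0$ for every pair of different points $x,y\in X$. *)

(* Defs.v *)
From HB Require Import structures.
From mathcomp Require Import all_boot all_order all_algebra.
From mathcomp Require Import all_classical all_reals all_analysis.

Set Implicit Arguments.
Unset Strict Implicit.
Unset Printing Implicit Defensive.

Import Order.TTheory GRing.Theory Num.Theory.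

Local Open Scope classical_set_scope.
Local Open Scope ring_scope.

(* A splitbij from setT to setT is a bijection bundled with its (unique)
   two-sided inverse, written f^-1 in fun_scope. *)
Definition homeomorphism (X : topologicalType)
    (f : {splitbij [set: X] >-> [set: X]}) : Prop :=
  continuous f /\ continuous (f^-1)%FUN.

Definition iterz (X : Type) (f : {splitbij [set: X] >-> [set: X]})
    (n : int) : X -> X :=
  match n with
  | Posz k => iter k f
  | Negz k => iter k.+1 (f^-1)%FUN (* Negz k is -(k+1) *)
  end.

(* {ptws X -> X} is X -> X with the product topology. *)
Definition ellisN (X : topologicalType) (f : X -> X) : set {ptws X -> X} :=
  closure [set (iter n f : {ptws X -> X}) | n in [set: nat]].

Definition ellisZ (X : topologicalType)
    (f : {splitbij [set: X] >-> [set: X]}) : set {ptws X -> X} :=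
  closure [set (iterz f n : {ptws X -> X}) | n in [set: int]].

Definition distal (R : realType) (X : metricType R)
    (f : {splitbij [set: X] >-> [set: X]}) : Prop :=
  forall x y : X, x <> y ->
    0 < inf [set mdist (iterz f n x) (iterz f n y) | n in [set: int]].

(* Main.v *)
Require Import Defs.
From mathcomp Require Import all_boot all_order all_algebra.
From mathcomp Require Import all_classical all_reals all_analysis.

(** Everything reduces to the claim that the identity is a pointwise limit of
    the iterates [f^n] with [n >= 1].  Granting this, composition on the left
    with the continuous map [f^-1] sends those iterates to the [f^n] with
    [n >= 0], so [f^-1] itself is a pointwise limit of nonnegative iterates;
    hence [ellisN f] is stable under [p |-> f^-1 \o p], contains every negative
    power of [f], and, being closed, contains [ellisZ f]
    ([ellisN_comp_inv]).  The other inclusion is monotonicity of the closure.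

    The claim is where distality enters.  Let [S] be the closure of the [f^n],
    [n >= 1], in the compact space [X^X].  It is closed under composition, and
    composition [p \o q] is continuous in [p], although in general not in [q].
    That one-sided continuity is enough for the theorem of Ellis and Numakura
    ([compact_semigroup_idempotent]): [S] contains an idempotent [u].  For each
    [x] the points [x] and [u x] have the same image under [u], so some [f^n]
    brings them as close together as desired; distality then forces [u x = x],
    that is, [u = id] ([distal_idempotent_id]). *)

Set Implicit Arguments.
Unset Strict Implicit.
Unset Printing Implicit Defensive.

Import Order.TTheory GRing.Theory Num.Theory.

Local Open Scope classical_set_scope.

Section RightTopologicalSemigroup.
Context {T : topologicalType} (mul : T -> T -> T).

Definition subsemigroup (A : set T) :=
  forall p q, A p -> A q -> A (mul p q).

Definition compact_subsemigroup (A : set T) :=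
  [/\ compact A, A !=set0 & subsemigroup A].

(** Zorn's lemma applied to compact subsemigroups under reverse inclusion: the
    intersection of a chain of them is nonempty by compactness.  To turn
    intersections into unions, a subsemigroup is encoded in the proof by the
    set [U] that is removed from [S]. *)
Lemma minimal_compact_subsemigroup (S : set T) :
  hausdorff_space T -> compact_subsemigroup S ->
  exists M : set T, [/\ M `<=` S, compact_subsemigroup M &
    forall N, N `<=` M -> compact_subsemigroup N -> N = M].
Proof.
move=> hT [cS S0 mS].
pose P : set (set T) := [set U | compact_subsemigroup (S `\` U)].
have [F FP Ftot|U [PU maxU]] := @Zorn_bigcup T P.
  have [F0|nF0] := pselect (F !=set0); last first.
    have -> : F = set0.
      by apply/seteqP; split=> // U FU; case: nF0; exists U.
    by rewrite bigcup_set0 /P /= setD0.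
  have clF U : F U -> closed (S `\` U).
    by move=> /FP[/(compact_closed hT)].
  have bF : Filter (filter_from F (fun U => S `\` U)).
    apply: filter_from_filter => // U V FU FV.
    have [UV|VU] := Ftot _ _ FU FV.
      by exists V => // x [Sx nV]; split; split => // Ux; exact/nV/UV.
    by exists U => // x [Sx nU]; split; split => // Vx; exact/nU/VU.
  have pF : ProperFilter (filter_from F (fun U => S `\` U)).
    by apply: filter_from_proper => U /FP[].
  (* A cluster point of the filter generated by the chain lies in all of its
     members, since these are closed. *)
  have [p [Sp clp]] : S `&` cluster (filter_from F (fun U => S `\` U)) !=set0.
    by apply: cS; case: F0 => U FU; exists U => // x [].
  rewrite /P /=.
  have -> : S `\` \bigcup_(U in F) U = \bigcap_(U in F) (S `\` U).
    apply/seteqP; split=> [x [Sx nU] U FU|x xU].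
      by split=> // Ux; apply: nU; exists U.
    split; first by case: F0 => U /xU[].
    by move=> [U FU Ux]; have [] := xU U FU.
  split.
  - apply: (subclosed_compact _ cS).
      exact: closed_bigI.
    by case: F0 => U FU x /(_ U FU)[].
  - exists p => U FU; apply: (clF U FU).
    by rewrite clusterE in clp; apply: clp; exists U.
  - move=> x y xF yF U FU; have [_ _ mU] := FP _ FU.
    exact: mU (xF U FU) (yF U FU).
exists (S `\` U); split => // N NM sN.
apply/seteqP; split => // m [Sm nUm]; apply: contrapT => nNm.
apply: (maxU (~` N)).
  split; first by move=> x Ux /NM[].
  by move=> /(_ m nNm).
rewrite /P/= setDE setCK; suff -> : S `&` N = N by [].
by apply/setIidr => x /NM[].
Qed.

(** Ellis-Numakura theorem: any element [p] of a minimal compact subsemigroup [M]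
    is idempotent.  Indeed [M p] is again a compact subsemigroup, so [M p = M]
    and [p = q p] for some [q] in [M]; then the [q] in [M] with [q p = p] form a
    compact subsemigroup as well, hence all of [M], so that [p p = p].  Both
    compactness claims use continuity in the left factor only. *)
Lemma compact_semigroup_idempotent (S : set T) :
  hausdorff_space T -> associative mul ->
  (forall q, continuous (mul ^~ q)) ->
  compact_subsemigroup S -> exists2 u, S u & mul u u = u.
Proof.
move=> hT mulA mulc /(minimal_compact_subsemigroup hT)[M [MS [cM M0 mM] minM]].
have [p Mp] := M0.
exists p; first exact: MS.
have Mp_eq : (mul ^~ p) @` M = M.
  apply: minM => [_ [q Mq <-]|]; first exact: mM.
  split.
  - apply: continuous_compact => //.
    exact/continuous_subspaceT/mulc.
  - by exists (mul p p), p.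
  - move=> _ _ [x Mx <-] [y My <-]; exists (mul (mul x p) y); last by rewrite !mulA.
    exact: mM (mM _ _ Mx Mp) My.
suff fixM : M `&` (mul ^~ p) @^-1` [set p] = M.
  by move: Mp; rewrite -fixM => -[].
apply: minM; first by move=> ? [].
split.
- apply: compact_closedI => //; apply: closed_comp; first by move=> *; exact: mulc.
  exact/accessible_closed_set1/hausdorff_accessible.
- by move: Mp; rewrite -{1}Mp_eq => -[q Mq qp]; exists q.
- move=> x y [Mx xp] [My yp]; split; first exact: mM.
  by rewrite /= -mulA yp.
Qed.

End RightTopologicalSemigroup.

Lemma closure_mapS {T U : topologicalType} (phi : T -> U) (A : set T) (B : set U) :
  continuous phi -> (forall x, A x -> closure B (phi x)) ->
  forall x, closure A x -> closure B (phi x).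
Proof.
move=> cphi AB; rewrite (closureE A) => x.
move=> /(_ (phi @^-1` closure B)); apply; split => //.
by apply: closed_comp => [? _|]; [exact: cphi|exact: closed_closure].
Qed.

Section Pointwise.
Context {X : uniformType}.
Implicit Types p q g : {ptws X -> X}.

Lemma eval_continuous (x : X) : continuous (fun p => p x).
Proof. by move=> p; have /pointwise_cvgP := @cvg_id _ (nbhs p); exact. Qed.

(** The coordinate of [p \o q] at [x] is the coordinate of [p] at [q x]; this is
    what makes [X^X] right-topological. *)
Lemma ptws_comp_continuousl q :
  continuous (fun p => p \o q : {ptws X -> X}).
Proof.
move=> p; apply: (iffRL (pointwise_cvgP (F := _ @ nbhs p) _ _)) => x.
exact: (@eval_continuous (q x) p).
Qed.

Lemma ptws_comp_continuousr g : continuous (g : X -> X) ->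
  continuous (fun p => g \o p : {ptws X -> X}).
Proof.
move=> cg p; apply: (iffRL (pointwise_cvgP (F := _ @ nbhs p) _ _)) => x.
apply: (@continuous_comp _ _ _ (fun p : {ptws X -> X} => p x) g p).
  exact: eval_continuous.
exact: cg.
Qed.

Lemma ptws_compact : compact [set: X] -> compact [set: {ptws X -> X}].
Proof.
move=> cX; have := @tychonoff X (fun=> X) (fun=> setT) (fun=> cX).
by congr compact; apply/seteqP.
Qed.

Definition positive_iterates (f : X -> X) : set {ptws X -> X} :=
  [set (iter n.+1 f : {ptws X -> X}) | n in [set: nat]].

(** The closure is taken in two stages, the left factor first: for a limit [q],
    [p |-> p \o q] is continuous, which reduces to [p] an iterate of [f]; such
    a [p] is continuous, so that [q |-> p \o q] is continuous too, which
    reduces to [q] an iterate. *)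
Lemma closure_positive_iterates_comp (f : X -> X) : continuous f ->
  subsemigroup (fun p q : {ptws X -> X} => p \o q : {ptws X -> X})
    (closure (positive_iterates f)).
Proof.
move=> cf p q clp clq.
have citer m : continuous (iter m f).
  elim: m => [|m ih] x; first exact: cvg_id.
  by apply: (@continuous_comp _ _ _ (iter m f) f); [exact: ih|exact: cf].
apply: (closure_mapS (@ptws_comp_continuousl q) _ clp) => _ [n _ <-].
apply: (closure_mapS (ptws_comp_continuousr (citer n.+1)) _ clq) => _ [m _ <-].
apply: subset_closure; exists (n + m.+1)%N => //.
by apply/funext => x; rewrite /= iterD.
Qed.

Lemma positive_iterates_idempotent (f : X -> X) :
  hausdorff_space X -> compact [set: X] -> continuous f ->
  exists2 u : {ptws X -> X}, closure (positive_iterates f) u & u \o u = u.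
Proof.
move=> hX cX cf.
apply: (compact_semigroup_idempotent (mul := fun p q : {ptws X -> X} =>
  p \o q : {ptws X -> X})) => //.
- exact: (@hausdorff_product X (fun=> X)).
- exact: ptws_comp_continuousl.
- split.
  + by apply: (subclosed_compact _ (ptws_compact cX)) => //; exact: closed_closure.
  + by exists (f : {ptws X -> X}); apply: subset_closure; exists 0%N.
  + exact: closure_positive_iterates_comp.
Qed.

End Pointwise.

Section Distal.
Local Open Scope ring_scope.
Context {R : realType} {X : metricType R} {f : {splitbij [set: X] >-> [set: X]}}.

Lemma distal_proximal_eq (x y : X) : distal f ->
  (forall e : R, 0 < e -> exists n, mdist (iterz f n x) (iterz f n y) < e) ->
  x = y.
Proof.
move=> df prox; apply: contrapT => /df; set A := [set _ | _ in _] => infA.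
have [n ltn] := prox _ infA.
suff : inf A <= mdist (iterz f n x) (iterz f n y) by rewrite leNgt ltn.
apply: ge_inf; last by exists n.
by exists 0 => _ [m _ <-]; exact: mdist_ge0.
Qed.

(** Near [u] in the product topology there are iterates [f^n] close to [u] at
    both [x] and [u x].  As [u (u x) = u x], such an [f^n] sends [x] and [u x] to
    points near the same limit. *)
Lemma distal_idempotent_id (u : {ptws X -> X}) : distal f ->
  closure (positive_iterates f) u -> u \o u = u -> u = id.
Proof.
move=> df clu uu; apply/funext => x; apply: (distal_proximal_eq df) => e e0.
have e20 : 0 < e / 2 by rewrite divr_gt0.
have near_u y : nbhs u [set p : {ptws X -> X} | ball (u y) (e / 2) (p y)].
  exact: (@eval_continuous X y u _ (nbhsx_ballx _ _ e20)).
have [_ [[n _ <-] [/= bux bx]]] := clu _ (filterI (near_u (u x)) (near_u x)).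
have uux : u (u x) = u x := congr1 (fun v : X -> X => v x) uu.
rewrite uux in bux.
exists (Posz n.+1).
have := ball_triangle (ball_sym bux) bx.
by rewrite -splitr ballEmdist.
Qed.

(** The exponents [n >= 1] matter: since [id] is the zeroth iterate, the statement
    would be trivial for the set of all iterates. *)
Lemma distal_id_recurrent : compact [set: X] -> continuous f -> distal f ->
  closure (positive_iterates f) (id : {ptws X -> X}).
Proof.
move=> cX cf df.
have [u clu uu] := positive_iterates_idempotent (@metric_hausdorff _ X) cX cf.
by rewrite -(distal_idempotent_id df clu uu).
Qed.

Lemma ellisN_comp_inv : compact [set: X] -> homeomorphism f -> distal f ->
  forall p : {ptws X -> X}, ellisN f p -> ellisN f ((f^-1)%FUN \o p).
Proof.
move=> cX [cf cfV] df p.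
have cancel_iter n : (f^-1)%FUN \o iter n.+1 f = iter n f.
  by apply/funext => x /=; rewrite funK ?inE.
apply: (closure_mapS (ptws_comp_continuousr cfV)) => _ [[|n] _ <-].
  (* The only iterate that [f^-1] does not shift back to an iterate is the
     identity, which is replaced by its approximations [f^n] with [n >= 1]. *)
  apply: (closure_mapS (ptws_comp_continuousr cfV) _ (distal_id_recurrent cX cf df)).
  move=> _ [n _ <-]; rewrite cancel_iter.
  by apply: subset_closure; exists n.
by rewrite cancel_iter; apply: subset_closure; exists n.
Qed.

End Distal.

Theorem theorem3p7 (R : realType) (X : metricType R)
  (f : {splitbij [set: X] >-> [set: X]})
  (X_compact : compact [set: X])
  (f_homeo : homeomorphism f) (f_distal : distal f) :
  ellisN f = ellisZ f.
Proof.
apply/seteqP; split.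
  by apply: closureS => _ [n _ <-]; exists (Posz n).
rewrite /ellisZ closureE; apply: smallest_sub; first exact: closed_closure.
move=> _ [[n|n] _ <-] /=; first by apply: subset_closure; exists n.
have inv_step := ellisN_comp_inv X_compact f_homeo f_distal.
elim: n.+1 => [|k ih]; first by apply: subset_closure; exists 0%N.
exact: inv_step ih.
Qed.
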